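(* Let $0<\alpha<1$ and $N\in\mathbb{N}$. Let $(Y,d)$ be a metric space containing at least $N$ points and let $X$ be a metric space which is free of $N$-point $\mathrm{SRA}(\alpha)$ subspaces. Then the $\alpha$-snowflake $(Y,d^\alpha)$ does not embed isometrically into $X$.
   Context: For a metric space $(Y,d)$ and $0<\alpha<1$, the $\alpha$-snowflake $(Y,d^\alpha)$ is the set $Y$ with the metric $d^\alpha(y_1,y_2)=(d(y_1,y_2))^\alpha$. A metric space $(Z,d)$ satisfies the $\mathrm{SRA}(\alpha)$ condition if for all $x,y,z\in Z$, $d(x,y)\le\max\{d(x,z)+\alpha d(z,y),\ \alpha d(x,z)+d(z,y)\}$. A metric space is free of $N$-point $\mathrm{SRA}(\alpha)$ subspaces if no $N$-point subset of it (with the induced metric) satisfies the $\mathrm{SRA}(\alpha)$ condition. An isometric embedding is a distance-preserving map (not necessarily surjective). *)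

(* Defs.v *)
From HB Require Import structures.
From mathcomp Require Import all_boot all_order all_algebra.
From mathcomp Require Import all_classical all_reals all_analysis.

Set Implicit Arguments.
Unset Strict Implicit.
Unset Printing Implicit Defensive.

Import Order.TTheory GRing.Theory Num.Theory.

Local Open Scope ring_scope.
Local Open Scope classical_set_scope.

Lemma powR_subadditive (R : realType) (a x y : R) :
  0 < a < 1 -> 0 <= x -> 0 <= y -> (x + y) `^ a <= x `^ a + y `^ a.
Proof.
move=> /andP[a0 a1] x0 y0.
have [s0|s0] := eqVneq (x + y) 0.
  by rewrite s0 powR0 ?gt_eqF// addr_ge0// powR_ge0.
have sp : 0 < x + y by rewrite lt_neqAle eq_sym s0 addr_ge0.
have key z : 0 <= z -> z <= x + y -> z / (x + y) * (x + y) `^ a <= z `^ a.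
  move=> z0 zs; have q0 : 0 <= z / (x + y) by rewrite divr_ge0// ltW.
  have -> : z `^ a = (z / (x + y)) `^ a * (x + y) `^ a.
    by rewrite -powRM ?divfK// ltW.
  apply: ler_wpM2r; first exact: powR_ge0.
  have [->|zn0] := eqVneq z 0; first by rewrite mul0r powR_ge0.
  apply: ger1_powR; last exact: ltW.
  by rewrite ler_pdivrMr// mul1r zs lt_neqAle q0 eq_sym mulf_neq0 ?invr_neq0.
apply: le_trans (lerD (key x x0 _) (key y y0 _)); rewrite ?lerDl ?lerDr//.
by rewrite -!mulrDl divff// mul1r.
Qed.

(* The bounds on [a] are arguments of the type itself, as they are what makes
   [d `^ a] a distance. *)
Definition snowflake (R : realType) (a : R) (a01 : 0 < a < 1)
  (Y : metricType R) : Type := Y.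

Section snowflake_metric.
Context {R : realType} {a : R} (a01 : 0 < a < 1) (Y : metricType R).

Let sdist (x y : snowflake a01 Y) : R := @mdist R Y x y `^ a.

Let a_neq0 : a != 0. Proof. by case/andP: a01 => a0 _; rewrite gt_eqF. Qed.

Let sdistxx x : sdist x x = 0.
Proof. by rewrite /sdist mdistxx powR0. Qed.

Let sdist_positivity x y : sdist x y = 0 -> x = y.
Proof. by move/powR_eq0_eq0/mdist_positivity. Qed.

Let sdist_sym x y : sdist x y = sdist y x.
Proof. by rewrite /sdist metric_sym. Qed.

Let sdist_triangle y x z : sdist x z <= sdist x y + sdist y z.
Proof.
apply: le_trans (powR_subadditive a01 (mdist_ge0 _ _) (mdist_ge0 _ _)).
case/andP: a01 => /ltW a0 _.
by apply: ge0_ler_powR; rewrite ?nnegrE ?addr_ge0 ?mdist_ge0 ?metric_triangle.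
Qed.

HB.instance Definition _ := Choice.copy (snowflake a01 Y) Y.
HB.instance Definition _ := @isMetric.Build R (snowflake a01 Y)
  sdist sdistxx sdist_positivity sdist_sym sdist_triangle.

Lemma mdist_snowflakeE (x y : snowflake a01 Y) :
  mdist x y = @mdist R Y x y `^ a.
Proof. by []. Qed.

End snowflake_metric.

Definition metric_subspace (R : realType) (Z : metricType R) (A : set Z) :
  Type := set_type A.

Section metric_subspace_metric.
Context {R : realType} {Z : metricType R} (A : set Z).

Let idist (x y : metric_subspace A) : R := mdist (set_val x) (set_val y).

Let idistxx x : idist x x = 0.
Proof. exact: mdistxx. Qed.

Let idist_positivity x y : idist x y = 0 -> x = y.
Proof. by move/mdist_positivity/val_inj. Qed.

Let idist_sym x y : idist x y = idist y x.
Proof. exact: metric_sym. Qed.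

Let idist_triangle y x z : idist x z <= idist x y + idist y z.
Proof. exact: metric_triangle. Qed.

HB.instance Definition _ := Choice.copy (metric_subspace A) (set_type A).
HB.instance Definition _ := @isMetric.Build R (metric_subspace A)
  idist idistxx idist_positivity idist_sym idist_triangle.

Lemma mdist_subspaceE (x y : metric_subspace A) :
  mdist x y = mdist (set_val x) (set_val y).
Proof. by []. Qed.

End metric_subspace_metric.

Definition SRA (R : realType) (a : R) (Z : metricType R) : Prop :=
  forall x y z : Z,
    mdist x y <= Num.max (mdist x z + a * mdist z y)
                         (a * mdist x z + mdist z y).

Definition free_of_SRA (R : realType) (N : nat) (a : R) (X : metricType R) :
  Prop :=
  forall A : set X, (A #= `I_N)%card -> ~ SRA a (metric_subspace A).

Definition isometric_embedding (R : realType) (Y X : metricType R)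
  (f : Y -> X) : Prop :=
  forall x y : Y, mdist (f x) (f y) = mdist x y.

(* Main.v *)
(* The snowflake itself satisfies SRA(a): if q <= p then concavity gives
   (p + q)^a <= p^a + a p^(a-1) q <= p^a + a q^a.  The SRA(a) condition is
   inherited by isometric images of subsets, so an isometric embedding sends
   any N points of Y to an N-point SRA(a) subspace of X. *)

Require Import Defs.
From mathcomp Require Import all_boot all_order all_algebra.
From mathcomp Require Import all_classical all_reals all_analysis.
From mathcomp Require Import lra.

Import Order.TTheory GRing.Theory Num.Theory.

Local Open Scope ring_scope.
Local Open Scope classical_set_scope.

Lemma powR_bernoulli (R : realType) (a t : R) :
  0 < a < 1 -> 0 <= t -> (1 + t) `^ a <= 1 + a * t.
Proof.
move=> /andP[a0 a1] t0.
have b0 : 0 < 1 - a by rewrite subr_gt0.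
(* Young's inequality for (1 + t)^a * 1 with exponents 1/a and 1/(1 - a) *)
have := @conjugate_powR R ((1 + t) `^ a) 1 a^-1 (1 - a)^-1.
rewrite powR_ge0 ler01 !invr_gt0 a0 b0 !invrK subrKC.
move=> /(_ isT isT isT isT erefl).
rewrite -powRrM divff ?gt_eqF// powRr1 ?addr_ge0// powR1 mulr1 => /le_trans.
by apply; lra.
Qed.

Lemma powR_add_le (R : realType) (a p q : R) :
  0 < a < 1 -> 0 <= q -> q <= p -> (p + q) `^ a <= p `^ a + a * q `^ a.
Proof.
move=> a01 q0 qp; have /andP[a0 a1] := a01.
have p0 : 0 <= p := le_trans q0 qp.
have [p_eq0|pn0] := eqVneq p 0.
  have -> : q = 0 by apply/eqP; rewrite eq_le q0 -p_eq0 qp.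
  by rewrite addr0 lerDl mulr_ge0 ?powR_ge0// ltW.
have pp : 0 < p by rewrite lt_neqAle eq_sym pn0.
have [t [t0 t1 ->]] : exists t, [/\ 0 <= t, t <= 1 & q = p * t].
  exists (q / p); split; first by rewrite divr_ge0.
    by rewrite ler_pdivrMr// mul1r.
  by rewrite mulrC divfK.
have tta : t <= t `^ a.
  have [->|tn0] := eqVneq t 0; first exact: powR_ge0.
  by rewrite ger1_powR ?(ltW a1)// t1 lt_neqAle eq_sym tn0 t0.
rewrite -{1}[p]mulr1 -mulrDr !powRM ?addr_ge0//.
rewrite mulrCA -{2}[p `^ a]mulr1 -mulrDr.
apply: ler_wpM2l; first exact: powR_ge0.
by apply: (le_trans (powR_bernoulli _ _ _ a01 t0)); rewrite lerD2l (ler_pM2l a0).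
Qed.

Lemma SRA_snowflake (R : realType) (a : R) (a01 : 0 < a < 1)
  (Y : metricType R) : SRA a (snowflake a01 Y).
Proof.
move=> x y z; rewrite !mdist_snowflakeE.
set p := @mdist R Y x z; set q := @mdist R Y z y.
have p0 : 0 <= p by exact: mdist_ge0.
have q0 : 0 <= q by exact: mdist_ge0.
have /le_trans : @mdist R Y x y `^ a <= (p + q) `^ a.
  have /andP[/ltW a0 _] := a01.
  by apply: ge0_ler_powR; rewrite ?nnegrE ?addr_ge0 ?mdist_ge0 ?metric_triangle.
(* The smaller of [p] and [q] takes the factor [a], which selects the branch of the maximum. *)
apply; rewrite le_max; have [qp|/ltW pq] := leP q p; apply/orP.
  by left; apply: powR_add_le.
by right; rewrite addrC [leRHS]addrC; apply: powR_add_le.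
Qed.

Lemma isometric_embedding_inj (R : realType) (Y X : metricType R)
  (f : Y -> X) : isometric_embedding f -> injective f.
Proof.
by move=> fi x y fxy; apply: mdist_positivity; rewrite -fi fxy mdistxx.
Qed.

(** The condition only involves distances between three points, so it can be checked on preimages
    under [f]. *)
Lemma SRA_isometric_image (R : realType) (a : R) (Y X : metricType R)
  (f : Y -> X) (C : set Y) :
  isometric_embedding f -> SRA a Y -> SRA a (metric_subspace (f @` C)).
Proof.
move=> fi sraY x y z; rewrite !mdist_subspaceE.
have fval (u : metric_subspace (f @` C)) : exists v, f v = set_val u.
  by have [v _ fv] := set_valP u; exists v.
have [x' <-] := fval x; have [y' <-] := fval y; have [z' <-] := fval z.
by rewrite !fi; apply: sraY.
Qed.

Theorem corollary7 (R : realType) (a : R) (a01 : 0 < a < 1) (N : nat)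
  (Y X : metricType R)
  (cardY : (`I_N #<= [set: Y])%card)
  (freeX : free_of_SRA N a X) :
  ~ exists f : snowflake a01 Y -> X, isometric_embedding f.
Proof.
move=> [f fi]; have /card_subP[C CN _] := cardY.
(* [C] consists of [N] points of [Y], read in the snowflake, which has the same carrier; its image
   still has [N] points since [f] is injective. *)
apply: (freeX (f @` (C : set (snowflake a01 Y)))).
  apply: card_eq_trans CN; apply: inj_card_eq => x y _ _.
  exact: isometric_embedding_inj fi _ _.
exact/SRA_isometric_image/SRA_snowflake.
Qed.
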